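(* Let $I\subset(0,\infty)$ be an interval, let $f:I\to\mathbb{R}$ be differentiable on $I^{\circ}$, and let $a,b\in I$ with $a<b$, where $f'$ exists at every point of $[a,b]$ (one-sided derivative at $a$ or $b$ if that point is an endpoint of $I$), and $f'\in L[a,b]$. Let $q>1$, $\frac1p+\frac1q=1$, and suppose $|f'|^q$ is harmonically convex on $[a,b]$. Then $$\left|f\left(\frac{2ab}{a+b}\right)-\frac{ab}{b-a}\int_a^b\frac{f(x)}{x^2}\,dx\right|$$ $$\le\frac{ab(b-a)}{2}\left\{C_1(0,p;a,b)^{\frac1p}\left(\frac{\left|f'\left(\frac{2ab}{a+b}\right)\right|^q+|f'(b)|^q}{4}\right)^{\frac1q}+C_1(0,p;b,a)^{\frac1p}\left(\frac{\left|f'\left(\frac{2ab}{a+b}\right)\right|^q+|f'(a)|^q}{4}\right)^{\frac1q}\right\},$$ where, for $\lambda\in[0,1]$ and $u,\vartheta>0$, $C_1(\lambda,p;u,\vartheta)=\int_0^{1/2}\frac{|\lambda-2t|^p}{(t\vartheta+(1-t)u)^{2p}}\,dt$.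
   Context: A function $g:J\to\mathbb{R}$ on an interval $J\subset\mathbb{R}\setminus\{0\}$ is harmonically convex if $g\left(\frac{xy}{tx+(1-t)y}\right)\le t\,g(y)+(1-t)\,g(x)$ for all $x,y\in J$ and $t\in[0,1]$. $L[a,b]$ denotes the Lebesgue integrable functions on $[a,b]$. *)

(* Defs.v *)
From HB Require Import structures.
From mathcomp Require Import all_boot all_order all_algebra.
From mathcomp Require Import all_classical all_reals all_analysis.

Set Implicit Arguments.
Unset Strict Implicit.
Unset Printing Implicit Defensive.

Import Order.TTheory GRing.Theory Num.Theory.
Import numFieldNormedType.Exports.

Local Open Scope classical_set_scope.
Local Open Scope ring_scope.

(* A function on an interval I is represented by a total function R -> R whose
   values outside I are irrelevant.  The limits below only look at points of I:
   at an interior point of I they give the usual derivative [derive1 f x] (see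
   [derivable_inE] and [derive_inE]), at an endpoint of I belonging to I the
   one-sided derivative. *)
Definition diff_quot (R : realType) (f : R -> R) (x y : R) : R :=
  (f y - f x) / (y - x).

Definition derivable_in (R : realType) (I : interval R) (f : R -> R) (x : R) :
    Prop :=
  cvg (diff_quot f x @ within [set` I] x^').

Definition derive_in (R : realType) (I : interval R) (f : R -> R) (x : R) : R :=
  lim (diff_quot f x @ within [set` I] x^').

Lemma diff_quot_interior (R : realType) (I : interval R) (f : R -> R) (x : R) :
  [set` I]° x ->
  diff_quot f x @ within [set` I] x^' =
  (fun h => h^-1 *: (f (h + x) - f x)) @ 0^'.
Proof.
move=> Ix.
have e1 : within [set` I] x^' = x^'.
  rewrite eqEsubset; split=> A; rewrite /within /dnbhs /=.
    move=> HA; have HI : nbhs x [set` I] by exact: Ix.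
    by apply: filterS2 HI HA => y Iy Ay yx; exact: Ay.
  by apply: filterS.
rewrite e1 eqEsubset; split=> A; rewrite /dnbhs /within /nbhs /=
  => /nbhs_ballP [e /= e0 He]; apply/nbhs_ballP; exists e => //= y.
- rewrite /ball /= sub0r normrN => ye y0.
  have := He (y + x); rewrite /diff_quot /ball /= opprD addrCA subrr addr0 normrN.
  rewrite -subr_eq0 addrK => /(_ ye y0).
  by rewrite mulrC.
- rewrite /ball /= => ye yx.
  have := He (y - x); rewrite /ball /= sub0r normrN distrC subr_eq0 subrK.
  by move=> /(_ ye yx); rewrite /diff_quot mulrC.
Qed.

Lemma derivable_inE (R : realType) (I : interval R) (f : R -> R) (x : R) :
  [set` I]° x -> derivable_in I f x <-> derivable f x 1.
Proof.
move=> Ix; rewrite /derivable_in diff_quot_interior// /derivable.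
by under [X in _ <-> cvg (X @ _)]eq_fun do rewrite [_ *: 1]mulr1.
Qed.

Lemma derive_inE (R : realType) (I : interval R) (f : R -> R) (x : R) :
  [set` I]° x -> derive_in I f x = derive1 f x.
Proof. by move=> Ix; rewrite /derive_in diff_quot_interior. Qed.

Definition harmonically_convex (R : realType) (J : interval R) (g : R -> R) :
    Prop :=
  0 \notin J /\
  forall x y t : R, x \in J -> y \in J -> t \in `[0, 1] ->
    g (x * y / (t * x + (1 - t) * y)) <= t * g y + (1 - t) * g x.

Definition C1 (R : realType) (lambda p u v : R) : R :=
  \int[@lebesgue_measure R]_(t in `[0, 2^-1])
    (`|lambda - 2 * t| `^ p / (t * v + (1 - t) * u) `^ (2 * p)).

(* Main.v *)
Require Import Defs.
From mathcomp Require Import all_boot all_order all_algebra.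
From mathcomp Require Import all_classical all_reals all_analysis.
From mathcomp Require Import measurable_realfun ring lra.
Import Order.TTheory GRing.Theory Num.Theory.
Import numFieldNormedType.Exports.
Local Open Scope classical_set_scope.
Local Open Scope ring_scope.

(** Put x(t) = uv / (tv + (1-t)u), let P be a primitive of f(y)/y^2 and
    Phi(t) = t f(x(t)) + uv/(v-u) P(x(t)).  The two terms not containing f'
    cancel in Phi', so Phi'(t) = t f'(x(t)) x'(t), and harmonic convexity bounds
    |f'(x(t))|^q on [0, 1/2] by the affine function interpolating the values of
    |f'|^q at v = x(0) and at the harmonic mean x(1/2).  The mean value theorem
    bounds the increment of Phi over [0, 1/2] by the integral of the resulting
    majorant, to which Hoelder's inequality applies; f' itself is never
    integrated.  Adding the cases (u, v) = (a, b) and (u, v) = (b, a) yields the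
    theorem. *)

(** * Integral inequalities: Hoelder on a set, and a mean value bound *)

Lemma Rintegral_hoelder d (T : measurableType d) (R : realType)
    (mu : {measure set T -> \bar R}) (D : set T) (f g : T -> R) (p q : R) :
  measurable D -> measurable_fun D f -> measurable_fun D g ->
  (forall x, D x -> 0 <= f x) -> (forall x, D x -> 0 <= g x) ->
  0 < p -> 0 < q -> p^-1 + q^-1 = 1 ->
  mu.-integrable D (EFin \o (fun x => f x `^ p)) ->
  mu.-integrable D (EFin \o (fun x => g x `^ q)) ->
  \int[mu]_(x in D) (f x * g x) <=
    (\int[mu]_(x in D) (f x `^ p)) `^ p^-1 *
    (\int[mu]_(x in D) (g x `^ q)) `^ q^-1.
Proof.
move=> mD mf mg f0 g0 p0 q0 pq ifp igq.
(* Extension by zero outside [D] reduces the claim to [hoelder] on the whole space. The extension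
   adds nothing to the norms, since 0 to a positive power is 0. *)
have mfD : measurable_fun setT (f \_ D) by apply/(measurable_restrictT f mD).
have mgD : measurable_fun setT (g \_ D) by apply/(measurable_restrictT g mD).
have normE r (k : T -> R) : 0 < r -> (forall x, D x -> 0 <= k x) ->
    mu.-integrable D (EFin \o (fun x => k x `^ r)) ->
    Lnorm mu r%:E (EFin \o (k \_ D)) =
    ((\int[mu]_(x in D) (k x `^ r)) `^ r^-1)%:E.
  move=> r0 k0 ik; rewrite unlock /Rintegral -poweR_EFin fineK; last first.
    exact: integrable_fin_num.
  congr (_ `^ _)%E; rewrite [RHS]integral_mkcond; apply: eq_integral => x _ /=.
  rewrite !patchE; case: ifPn => [/set_mem Dx|_].
    by rewrite ger0_norm ?k0.
  by rewrite normr0 powR0 ?gt_eqF.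
have := hoelder mu mfD mgD p0 q0 pq.
rewrite (normE p f)// (normE q g)// -EFinM Lnorm1.
have -> : (\int[mu]_x `|(EFin \o (f \_ D \* g \_ D)%R) x| =
    \int[mu]_(x in D) (f x * g x)%R%:E)%E.
  rewrite [RHS]integral_mkcond; apply: eq_integral => x _ /=.
  rewrite !patchE; case: ifPn => [/set_mem Dx|_].
    by rewrite ger0_norm// mulr_ge0 ?f0 ?g0.
  by rewrite mulr0 normr0.
have : (0 <= \int[mu]_(x in D) (f x * g x)%R%:E)%E.
  by apply: integral_ge0 => x Dx; rewrite lee_fin mulr_ge0 ?f0 ?g0.
(* The integral of the product is finite, so [fine] loses nothing: the Hoelder bound excludes [+oo]
   and nonnegativity excludes [-oo]. *)
by rewrite /Rintegral; case: integral.
Qed.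

(** With [P] the integral of [H] from [a], the bound on the derivative makes [F - P] nonincreasing
    and [F + P] nondecreasing. Comparing their values at [a] and [b] gives the two signs of the
    estimate. *)
Lemma le_norm_derive1_Rintegral (R : realType) (F H : R -> R) (a b : R) :
  a <= b -> {within `[a, b], continuous F} ->
  (@lebesgue_measure R).-integrable `[a, b] (EFin \o H) ->
  {in `]a, b[, forall x, {for x, continuous H}} ->
  {in `]a, b[, forall x, derivable F x 1 /\ `|derive1 F x| <= H x} ->
  `|F b - F a| <= \int[@lebesgue_measure R]_(x in `[a, b]) H x.
Proof.
move=> ab cF iH cH dF.
pose P := parameterized_integral (@lebesgue_measure R) a ^~ H.
have cP : {within `[a, b], continuous P} by exact: parameterized_integral_continuous.
have Pa : P a = 0 by rewrite /P /parameterized_integral set_itv1 Rintegral_set1.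
have dP x : x \in `]a, b[ -> derivable P x 1 /\ derive1 P x = H x.
  move=> /[dup] xab; rewrite in_itv/= => /andP[ax xb].
  exact: (continuous_FTC1_closed xb iH ax (cH _ xab)).
have aab : a \in `[a, b] by rewrite in_itv/= lexx.
have bab : b \in `[a, b] by rewrite in_itv/= lexx ab.
have le1 : (F - P) b <= (F - P) a.
  apply: (@ler0_derive1_le_cc _ (F - P) a b _ _ _) => //.
  - by move=> x xab; apply: derivableB; [case: (dF _ xab)|case: (dP _ xab)].
  - move=> x xab; have [dFx Fx] := dF _ xab; have [dPx Px] := dP _ xab.
    rewrite derive1E deriveB// -!derive1E Px subr_le0.
    exact: le_trans (ler_norm _) Fx.
  - exact: within_continuousB.
have le2 : (F + P) a <= (F + P) b.
  apply: (@ger0_derive1_le_cc _ (F + P) a b _ _ _) => //.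
  - by move=> x xab; apply: derivableD; [case: (dF _ xab)|case: (dP _ xab)].
  - move=> x xab; have [dFx Fx] := dF _ xab; have [dPx Px] := dP _ xab.
    rewrite derive1E deriveD// -!derive1E Px.
    by move: Fx; rewrite ler_norml => /andP[]; lra.
  - exact: within_continuousD.
have {}le1 : F b - P b <= F a by rewrite -[leRHS]subr0 -Pa.
have {}le2 : F a <= F b + P b by rewrite -[leLHS]addr0 -Pa.
by rewrite -[leRHS]/(P b) ler_norml; apply/andP; split; lra.
Qed.

(** * Continuity, integrability and one explicit integral on segments *)

(** Serves to compose [f] and its companion [P], continuous only relative to [a, b], with a path
    that may start at an end point of [a, b]. *)
Lemma within_continuous_comp_sub (S T U : topologicalType) (A : set S)
    (B : set T) (f : S -> T) (g : T -> U) :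
  {within A, continuous f} -> {within B, continuous g} ->
  (forall x, A x -> B (f x)) -> {within A, continuous (g \o f)}.
Proof.
move=> /subspace_continuousP cf /subspace_continuousP cg AB.
apply/subspace_continuousP => x Ax.
apply: (cvg_comp f g _ (cg _ (AB _ Ax))) => V /= BV.
have := cf x Ax _ BV; rewrite /nbhs /= /within /=.
by apply: filterS => y BVy Ay; exact: (BVy Ay (AB _ Ay)).
Qed.

Lemma ge0_bounded_integrable (R : realType) (a b M : R) (f : R -> R) :
  measurable_fun `[a, b] f -> {in `[a, b], forall x, 0 <= f x <= M} ->
  (@lebesgue_measure R).-integrable `[a, b] (EFin \o f).
Proof.
move=> mf fM; apply: measurable_bounded_integrable => //.
  by rewrite /= lebesgue_measure_itv/=; case: ifP => // _; rewrite -EFinB ltry.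
exists M; split; rewrite ?num_real// => N MN x /fM /andP[f0 fN].
by rewrite /= ger0_norm// (le_trans fN)// ltW.
Qed.

(** The integrand runs affinely from [c] at 0 to [d] at 1/2, so its integral is the mean of [c] and
    [d] times the length 1/2. This is the source of the 4 in the final bound. *)
Lemma Rintegral_affine_half (R : realType) (c d : R) :
  \int[@lebesgue_measure R]_(t in `[0, 2^-1])
    ((1 - 2 * t) * c + 2 * t * d) = (d + c) / 4.
Proof.
pose F (t : R) : R := t * c + t * t * (d - c).
have dF (x : R) : is_derive x 1 F ((1 - 2 * x) * c + 2 * x * d).
  by apply: is_derive_eq; rewrite /GRing.scale /=; ring.
rewrite /Rintegral (@continuous_FTC2 _ _ F)//=.
- by rewrite /F; field.
- apply: continuous_subspaceT => x; apply: cvgD; apply: cvgMl.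
    by apply: cvgB; [exact: cvg_cst|apply: cvgMr; exact: cvg_id].
  by apply: cvgMr; exact: cvg_id.
- have cF x : {for x, continuous F}.
    by apply/differentiable_continuous/derivable1_diffP; case: (dF x).
  split; first by move=> x _; case: (dF x).
  + by apply: cvg_at_right_filter; exact: cF.
  + by apply: cvg_at_left_filter; exact: cF.
- by move=> x _; rewrite derive1E; case: (dF x).
Qed.

(** * Weighted harmonic means of two positive numbers *)

Lemma affine_gt0 (R : realType) (u v t : R) :
  0 < u -> 0 < v -> 0 <= t <= 1 -> 0 < t * v + (1 - t) * u.
Proof.
move=> u0 v0 /andP[t0 t1].
have [->|tn0] := eqVneq t 0; first by rewrite mul0r subr0 mul1r add0r.
have tgt0 : 0 < t by rewrite lt_def tn0.
by rewrite ltr_pwDl ?mulr_gt0// mulr_ge0 ?subr_ge0// ltW.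
Qed.

(** The reciprocal of the quotient is t/u + (1 - t)/v, a convex combination of 1/u and 1/v. *)
Lemma harmonic_mean_itv (R : realType) (a b u v t : R) :
  0 < a -> u \in `[a, b] -> v \in `[a, b] -> 0 <= t <= 1 ->
  u * v / (t * v + (1 - t) * u) \in `[a, b].
Proof.
move=> a0; rewrite !in_itv/= => /andP[au ub] /andP[av vb] /[dup] t01 /andP[t0 t1].
have u0 := lt_le_trans a0 au; have v0 := lt_le_trans a0 av.
have A0 : 0 < t * v + (1 - t) * u by exact: affine_gt0.
have tv0 : 0 <= t * v by rewrite mulr_ge0// ltW.
have tu0 : 0 <= (1 - t) * u by rewrite mulr_ge0 ?subr_ge0// ltW.
by rewrite ler_pdivlMr// ler_pdivrMr//; apply/andP; split; nra.
Qed.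

(** With [u] and [v] distinct and both weights positive the inequalities become strict. This keeps
    the path, at interior times, where [f] has a two-sided derivative. *)
Lemma harmonic_mean_itvoo (R : realType) (a b u v t : R) :
  0 < a -> u \in `[a, b] -> v \in `[a, b] -> u != v -> 0 < t < 1 ->
  u * v / (t * v + (1 - t) * u) \in `]a, b[.
Proof.
move=> a0; rewrite !in_itv/= => /andP[au ub] /andP[av vb] uv /andP[t0 t1].
have u0 := lt_le_trans a0 au; have v0 := lt_le_trans a0 av.
have A0 : 0 < t * v + (1 - t) * u by rewrite affine_gt0// !ltW.
have tv0 : 0 < t * v by exact: mulr_gt0.
have tu0 : 0 < (1 - t) * u by rewrite mulr_gt0// subr_gt0.
rewrite ltr_pdivlMr// ltr_pdivrMr//.
by case: (ltgtP u v) uv => // uv _; apply/andP; split; nra.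
Qed.

Lemma is_derive_harmonic_mean (R : realType) (u v t : R) :
  t * v + (1 - t) * u != 0 ->
  is_derive t (1 : R) (fun s : R => u * v / (s * v + (1 - s) * u))
    (- (u * v * (v - u) / (t * v + (1 - t) * u) ^+ 2)).
Proof.
move=> A0.
have dA : is_derive t (1 : R) (fun s : R => s * v + (1 - s) * u) (v - u).
  by apply: is_derive_eq; rewrite /GRing.scale /=; ring.
have dV := is_deriveV (f := fun s : R => s * v + (1 - s) * u) A0 dA.
by apply: is_derive_eq; rewrite /GRing.scale /=; field.
Qed.

(** * Real powers *)

Lemma le_powRV (R : realType) (x y q : R) :
  0 <= x -> 0 <= y -> 0 < q -> x `^ q <= y -> x <= y `^ q^-1.
Proof.
move=> x0 y0 q0 xy.
have -> : x = (x `^ q) `^ q^-1 by rewrite -powRrM mulfV ?gt_eqF// powRr1.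
by apply: ge0_ler_powR => //; rewrite ?invr_ge0 ?nnegrE ?powR_ge0// ltW.
Qed.

(** At an interior time both weights are positive, so the base vanishes only if [c] and [d] are both
    0, and then the function is constant. Otherwise the base is positive and the power function is
    differentiable there. *)
Lemma continuous_affine_powR (R : realType) (c d r t : R) :
  0 <= c -> 0 <= d -> 0 < t < 2^-1 -> r != 0 ->
  {for t, continuous (fun t : R => ((1 - 2 * t) * c + 2 * t * d) `^ r)}.
Proof.
move=> c0 d0 /andP[t0 t2] r0.
have [B0|B0] := eqVneq ((1 - 2 * t) * c + 2 * t * d) 0.
  have cE : c = 0 by nra.
  have dE : d = 0 by nra.
  rewrite cE dE.
  under [X in {for _, continuous X}]eq_fun do rewrite !mulr0 addr0.
  exact: cvg_cst.
have {}B0 : 0 < (1 - 2 * t) * c + 2 * t * d by rewrite lt_def B0/=; nra.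
apply: (@continuous_comp _ _ _ (fun t : R => (1 - 2 * t) * c + 2 * t * d)
  (fun x => x `^ r)).
  apply: cvgD; apply: cvgMl.
    by apply: cvgB; [exact: cvg_cst|apply: cvgMr; exact: cvg_id].
  by apply: cvgMr; exact: cvg_id.
by apply/differentiable_continuous/derivable1_diffP; case: (is_derive1_powR r B0).
Qed.

(** * The estimate between one end point and the harmonic mean *)

(** The order of [u] and [v] is left open, whence [|v - u|], so that one statement covers both
    halves of the theorem. Derivatives are assumed only inside ]a, b[, because at [a] and [b] they
    may be one-sided. *)
Lemma half_midpoint_bound (R : realType) (a b u v h p q : R) (f f' P : R -> R) :
  0 < a -> u \in `[a, b] -> v \in `[a, b] -> u != v ->
  {within `[a, b], continuous f} -> {within `[a, b], continuous P} ->
  {in `]a, b[, forall x : R, is_derive x (1 : R) f (f' x)} ->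
  {in `]a, b[, forall x : R, is_derive x (1 : R) P (f x / x ^+ 2)} ->
  1 < q -> p^-1 + q^-1 = 1 ->
  harmonically_convex `[a, b] (fun x => `|f' x| `^ q) ->
  h = 2 * u * v / (u + v) ->
  `|f h / 2 + u * v / (v - u) * (P h - P v)| <=
    u * v * `|v - u| / 2 *
    (C1 0 p u v `^ p^-1 *
     ((`|f' h| `^ q + `|f' v| `^ q) / 4) `^ q^-1).
Proof.
move=> a0 uab vab uv cf cP df dP q1 pq [_ hc] hE.
have q0 : 0 < q by exact: lt_trans q1.
have p0 : 0 < p.
  by rewrite -invr_gt0 -(addrK q^-1 p^-1) pq subr_gt0 invf_lt1.
have u0 : 0 < u by move: uab; rewrite in_itv/= => /andP[+ _]; exact: lt_le_trans.
have v0 : 0 < v by move: vab; rewrite in_itv/= => /andP[+ _]; exact: lt_le_trans.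
have uv0 : v - u != 0 by rewrite subr_eq0 eq_sym.
pose A (t : R) : R := t * v + (1 - t) * u.
pose x (t : R) : R := u * v / A t.
have A_gt0 (t : R) : 0 <= t <= 1 -> 0 < A t by exact: affine_gt0.
have A_neq0 (t : R) : 0 <= t <= 1 -> A t != 0 by move=> /A_gt0/gt_eqF ->.
have half01 (t : R) : t \in `[0, 2^-1] -> 0 <= t <= 1 by rewrite in_itv/=; lra.
have xab (t : R) : 0 <= t <= 1 -> x t \in `[a, b] by exact: harmonic_mean_itv.
have xoo (t : R) : 0 < t < 1 -> x t \in `]a, b[ by exact: harmonic_mean_itvoo.
have x0 : x 0 = v by rewrite /x /A; field; rewrite gt_eqF.
have xh : x 2^-1 = h.
  by rewrite /x /A hE; field; rewrite !gt_eqF// addr_gt0.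
have dx (t : R) : 0 <= t <= 1 -> is_derive t (1 : R) x (- (u * v * (v - u) / A t ^+ 2)).
  by move=> /A_neq0; exact: is_derive_harmonic_mean.
have cx : {within `[0, 2^-1], continuous x}.
  by apply: derivable_within_continuous => t /half01/dx[].
pose g1 := `|f' h| `^ q; pose g0 := `|f' v| `^ q.
have g0_ge0 : 0 <= g0 by exact: powR_ge0.
have g1_ge0 : 0 <= g1 by exact: powR_ge0.
pose B (t : R) : R := (1 - 2 * t) * g0 + 2 * t * g1.
have B_bnd (t : R) : t \in `[0, 2^-1] -> 0 <= B t <= g0 + g1.
  by rewrite in_itv/= /B => /andP[t0 t1]; apply/andP; split; nra.
have f'B (t : R) : t \in `[0, 2^-1] -> `|f' (x t)| <= B t `^ q^-1.
  move=> tI; apply: le_powRV => //; first by case/andP: (B_bnd _ tI).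
  have hab : h \in `[a, b] by rewrite -xh xab// invr_ge0 invf_le1//; lra.
  have t2 : 2 * t \in `[0, 1] by move: tI; rewrite !in_itv/=; lra.
  (* The path goes from [v] at time 0 to [h] at time 1/2, and [x t] is the harmonic mean of these
     two with weight [2 * t]; so convexity between [v] and [h] yields exactly [B t]. *)
  have := hc v h (2 * t) vab hab t2; rewrite [leRHS]addrC.
  suff -> : v * h / (2 * t * v + (1 - 2 * t) * h) = x t by [].
  have := A_neq0 _ (half01 _ tI); rewrite /x hE /A => At0.
  have uv0' : u + v != 0 by rewrite gt_eqF// addr_gt0.
  have e : 2 * t * v + (1 - 2 * t) * (2 * u * v / (u + v)) =
      2 * v * (t * v + (1 - t) * u) / (u + v) by field.
  by rewrite e; field; rewrite At0 uv0' gt_eqF.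
pose c := u * v / (v - u).
pose Phi t := t * f (x t) + c * P (x t).
have cPhi : {within `[0, 2^-1], continuous Phi}.
  have cfx : {within `[0, 2^-1], continuous (f \o x)}.
    by apply: (within_continuous_comp_sub _ _ _ _ _ _ _ cx cf) => t /half01/xab.
  have cPx : {within `[0, 2^-1], continuous (P \o x)}.
    by apply: (within_continuous_comp_sub _ _ _ _ _ _ _ cx cP) => t /half01/xab.
  move=> t; apply: cvgD; apply: cvgM; [|exact: cfx|exact: cvg_cst|exact: cPx].
  by apply: continuous_subspaceT => s; exact: cvg_id.
have dPhi (t : R) : t \in `]0, 2^-1[ ->
    is_derive t (1 : R) Phi (- (t * f' (x t) * (u * v * (v - u) / A t ^+ 2))).
  rewrite in_itv/= => t02.
  have t01 : 0 <= t <= 1 by lra.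
  have xt : x t \in `]a, b[ by apply: xoo; lra.
  have dxt := dx _ t01; have At := A_neq0 _ t01.
  have dfx := @is_derive1_comp _ f x t _ _ (df _ xt) dxt.
  have dPx := @is_derive1_comp _ P x t _ _ (dP _ xt) dxt.
  have -> : Phi = id * (f \o x) + (cst c * (P \o x)) by [].
  apply: is_derive_eq.
  (* With x' the derivative of the path, c x'(t) / x(t)^2 = -1; hence the term f(x(t)) of the
     product rule cancels against the contribution of [P]. *)
  rewrite /GRing.scale /= /c {1 3 4}/x; field.
  by rewrite At uv0 !gt_eqF.
(* The majorant of the derivative of [Phi] is split as [K / 2 * (X t * Y t)]. The 2 is put into [X]
   so that the integral of its [p]-th power is exactly [C1 0 p u v]; the [q]-th power of [Y] is the
   affine function [B]. *)
pose X t := 2 * t / A t ^+ 2.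
pose Y t := B t `^ q^-1.
pose K := u * v * `|v - u|.
(* Here 2t is at most 1, and [A t], a convex combination of [u] and [v], is at least [a]. The bound
   serves for integrability only. *)
have X_bnd (t : R) : t \in `[0, 2^-1] -> 0 <= X t <= (a ^+ 2)^-1.
  move=> tI; have := A_gt0 _ (half01 _ tI) => At0.
  have Aa : a <= A t.
    by move: tI uab vab; rewrite !in_itv/= /A => /andP[t0 t1] /andP[ua _] /andP[va _]; nra.
  move: tI; rewrite in_itv/= => /andP[t0 t1]; apply/andP; split.
    by rewrite divr_ge0 ?exprn_ge0 ?mulr_ge0// ltW.
  rewrite ler_pdivrMr ?exprn_gt0// ler_pdivlMl ?exprn_gt0//.
  have a2 : a ^+ 2 <= A t ^+ 2 by rewrite lerXn2r ?nnegrE// ltW.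
  by apply: le_trans a2; rewrite ler_piMr ?exprn_ge0 ?(ltW a0)//; lra.
have cX : {within `[0, 2^-1], continuous X}.
  apply: derivable_within_continuous => t /half01/[dup] t01 /A_neq0 At.
  have dA : is_derive t (1 : R) A (v - u).
    by apply: is_derive_eq; rewrite /GRing.scale /=; ring.
  have A2 : A t * A t != 0 by rewrite mulf_neq0.
  have dV := is_deriveV (f := A * A) A2 (is_deriveM dA dA).
  have -> : X = ( *%R (2 : R)) * (fun s => ((A * A) s)^-1) by [].
  apply: derivableM; first exact: derivableM.
  by case: dV.
have mX : measurable_fun `[0 : R, 2^-1] X.
  by apply: subspace_continuous_measurable_fun.
have cB : continuous B.
  move=> t; apply: cvgD; apply: cvgMl.
    by apply: cvgB; [exact: cvg_cst|apply: cvgMr; exact: cvg_id].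
  by apply: cvgMr; exact: cvg_id.
have mY : measurable_fun `[0 : R, 2^-1] Y.
  apply: (measurableT_comp (measurable_powR _)).
  by apply: subspace_continuous_measurable_fun => //; exact: continuous_subspaceT.
have Y_bnd (t : R) : t \in `[0, 2^-1] -> 0 <= Y t <= (g0 + g1) `^ q^-1.
  move=> /B_bnd /andP[B0 B1]; rewrite powR_ge0/= ge0_ler_powR ?nnegrE ?invr_ge0 ?(ltW q0)//.
  exact: le_trans B1.
have K0 : 0 <= K / 2 by rewrite divr_ge0// !mulr_ge0// ltW.
have iXY : (@lebesgue_measure R).-integrable `[0, 2^-1]
    (EFin \o (fun t => X t * Y t)).
  apply: (@ge0_bounded_integrable _ _ _ ((a ^+ 2)^-1 * (g0 + g1) `^ q^-1)).
    exact: measurable_funM.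
  move=> t tI; have /andP[Xt0 Xt] := X_bnd _ tI; have /andP[Yt0 Yt] := Y_bnd _ tI.
  by rewrite mulr_ge0//= ler_pM.
have cXY (t : R) : t \in `]0, 2^-1[ -> {for t, continuous (fun t => X t * Y t)}.
  move=> tI; apply: cvgM.
    by apply: (within_continuous_continuous _ cX tI); rewrite invr_gt0.
  have t02 : 0 < t < 2^-1 by move: tI; rewrite in_itv.
  have q'0 : q^-1 != 0 by rewrite invr_eq0 gt_eqF.
  exact: (continuous_affine_powR _ _ _ _ _ g0_ge0 g1_ge0 t02 q'0).
have iX : (@lebesgue_measure R).-integrable `[0, 2^-1]
    (EFin \o (fun t => X t `^ p)).
  apply: (@ge0_bounded_integrable _ _ _ ((a ^+ 2)^-1 `^ p)).
    exact: (measurableT_comp (measurable_powR _)).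
  move=> t /X_bnd/andP[Xt0 Xt].
  by rewrite powR_ge0/= ge0_ler_powR ?nnegrE ?(ltW p0)// (le_trans Xt0).
have YB (t : R) : t \in `[0, 2^-1] -> Y t `^ q = B t.
  by move=> /B_bnd/andP[B0 _]; rewrite -powRrM mulVf ?gt_eqF// powRr1.
have iY : (@lebesgue_measure R).-integrable `[0, 2^-1]
    (EFin \o (fun t => Y t `^ q)).
  apply: (@ge0_bounded_integrable _ _ _ (g0 + g1)).
    exact: (measurableT_comp (measurable_powR _)).
  by move=> t tI; rewrite YB// B_bnd.
have XE : \int[@lebesgue_measure R]_(t in `[0, 2^-1]) (X t `^ p) = C1 0 p u v.
  apply: eq_Rintegral => t; rewrite inE/= => /[dup] tI /half01/A_gt0 At0.
  have t0 : 0 <= 2 * t by move: tI; rewrite in_itv/=; lra.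
  rewrite sub0r normrN (ger0_norm t0) /X powRM//; last by rewrite invr_ge0 exprn_ge0// ltW.
  by rewrite -(powR_invn 2 (ltW At0)) -powRrM mulNr powRN.
have YE : \int[@lebesgue_measure R]_(t in `[0, 2^-1]) (Y t `^ q) = (g1 + g0) / 4.
  rewrite -Rintegral_affine_half; apply: eq_Rintegral => t; rewrite inE/=.
  exact: YB.
(* The weight [t] in [Phi] removes the value of [f] at [v] and leaves half of its value at [h]. *)
have -> : f h / 2 + u * v / (v - u) * (P h - P v) = Phi 2^-1 - Phi 0.
  by rewrite /Phi xh x0 /c; field.
have half0 : 0 <= 2^-1 :> R by rewrite invr_ge0.
have bound := le_norm_derive1_Rintegral R Phi (fun t => K / 2 * (X t * Y t))
  0 2^-1 half0 cPhi.
apply: le_trans (bound _ _ _) _.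
- apply: (@ge0_bounded_integrable _ _ _ (K / 2 * ((a ^+ 2)^-1 * (g0 + g1) `^ q^-1))).
    by apply: measurable_funM => //; exact: measurable_funM.
  move=> t tI; have /andP[Xt0 Xt] := X_bnd _ tI; have /andP[Yt0 Yt] := Y_bnd _ tI.
  apply/andP; split; first by apply: mulr_ge0 => //; exact: mulr_ge0.
  by apply: ler_wpM2l => //; exact: ler_pM.
- by move=> t tI; apply: cvgMr; exact: cXY.
- move=> t tI; have [dP1 PhiE] := dPhi _ tI; split => //.
  have tI' : t \in `[0, 2^-1] by apply: subset_itv_oo_cc tI.
  have t0 : 0 <= t by move: tI'; rewrite in_itv/= => /andP[].
  have At0 := A_gt0 _ (half01 _ tI').
  rewrite derive1E PhiE normrN !normrM normrV ?unitfE ?expf_neq0 ?gt_eqF//.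
  rewrite normrX (ger0_norm t0) (ger0_norm (ltW At0)).
  rewrite (ger0_norm (ltW u0)) (ger0_norm (ltW v0)) -/K.
  have -> : K / 2 * (X t * Y t) = t * Y t * (K / A t ^+ 2).
    by rewrite /X; field; rewrite gt_eqF.
  rewrite ler_wpM2r ?ler_wpM2l ?f'B// divr_ge0 ?exprn_ge0 ?(ltW At0)//.
  by rewrite !mulr_ge0// ltW.
rewrite RintegralZl// ler_wpM2l// -XE -YE.
apply: Rintegral_hoelder => //.
- by move=> t tI; case/andP: (X_bnd _ tI).
- by move=> t tI; case/andP: (Y_bnd _ tI).
Qed.

(** * Differentiability relative to an interval *)

(** Away from [x], f(y) is the difference quotient times y - x, plus f(x), and the product tends to
    0. The limit of the quotient is punctured while the conclusion is not, so y = x is treated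
    apart. *)
Lemma derivable_in_cvg (R : realType) (I : interval R) (f : R -> R) (x : R) :
  derivable_in I f x -> f y @[y --> within [set` I] (nbhs x)] --> f x.
Proof.
move=> dfx.
set q := lim (diff_quot f x @ within [set` I] x^').
have cq : diff_quot f x @ within [set` I] x^' --> q by exact: dfx.
have c0 : (y - x) @[y --> within [set` I] x^'] --> (0 : R).
  rewrite -(subrr x); apply: cvgB; last exact: cvg_cst.
  move=> V; rewrite /nbhs /= /within /dnbhs /within /=.
  by apply: filterS.
have cf : diff_quot f x y * (y - x) + f x @[y --> within [set` I] x^'] --> f x.
  rewrite -[X in _ --> X]add0r -[X in _ --> X + _](mulr0 q).
  exact: (cvgD (cvgM cq c0) (cvg_cst (f x))).
move=> V Vfx.
have H : nbhs x [set y | y != x -> y \in I ->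
  V (diff_quot f x y * (y - x) + f x)] := cf V Vfx.
change (nbhs x [set y | y \in I -> V (f y)]).
apply: filterS H => y Hy Iy.
have [->|yx] := eqVneq y x; first exact: nbhs_singleton.
by have := Hy yx Iy; rewrite /diff_quot divfK ?subr_eq0// subrK.
Qed.

Lemma derivable_in_continuous (R : realType) (I : interval R) (f : R -> R) (a b : R) :
  `[a, b] `<=` [set` I] -> {in `[a, b], forall x, derivable_in I f x} ->
  {within `[a, b], continuous f}.
Proof.
move=> abI df; apply/subspace_continuousP => x xab.
apply: cvg_trans (derivable_in_cvg _ _ _ _ (df x xab)).
by apply: cvg_app; exact: within_subset.
Qed.

(** The second inclusion places ]a, b[ where [derive_in] agrees with the ordinary derivative. *)
Lemma itv_sub_interior (R : realType) (I : interval R) (a b : R) :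
  a \in I -> b \in I ->
  `[a, b] `<=` [set` I] /\ `]a, b[ `<=` [set` I]°.
Proof.
move=> aI bI.
have abI : `[a, b] `<=` [set` I] by move=> x; exact: (interval_is_interval aI bI).
split=> //; apply: (subset_trans _ (interiorS abI)).
by rewrite interior_itv_bnd.
Qed.

(** * Combination of the two half estimates *)

Theorem corollary4 (R : realType) (I : interval R) (f : R -> R) (a b p q : R)
  (Ipos : forall x : R, x \in I -> 0 < x)
  (fI : forall x : R, [set` I]° x -> derivable f x 1)
  (aI : a \in I) (bI : b \in I) (ab : a < b)
  (fab : forall x : R, x \in `[a, b] -> derivable_in I f x)
  (intf' : (@lebesgue_measure R).-integrable `[a, b] (EFin \o derive_in I f))
  (q1 : 1 < q) (pq : p^-1 + q^-1 = 1)
  (hc : harmonically_convex `[a, b] (fun x => `|derive_in I f x| `^ q)) :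
  let f' := derive_in I f in
  let h := 2 * a * b / (a + b) in
  `| f h - a * b / (b - a)
       * \int[@lebesgue_measure R]_(x in `[a, b]) (f x / x ^+ 2) |
  <= a * b * (b - a) / 2
     * (C1 0 p a b `^ p^-1
          * ((`|f' h| `^ q + `|f' b| `^ q) / 4) `^ q^-1
        + C1 0 p b a `^ p^-1
          * ((`|f' h| `^ q + `|f' a| `^ q) / 4) `^ q^-1).
Proof.
set f' := derive_in I f; set h := 2 * a * b / (a + b); cbv zeta.
have a0 : 0 < a := Ipos _ aI.
have b0 : 0 < b := Ipos _ bI.
have [abI abI'] := itv_sub_interior R I a b aI bI.
have aab : a \in `[a, b] by rewrite in_itv/= lexx ltW.
have bab : b \in `[a, b] by rewrite in_itv/= lexx ltW.
have cf : {within `[a, b], continuous f}.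
  by apply: (derivable_in_continuous _ _ _ _ _ abI) => x /fab.
have df : {in `]a, b[, forall x : R, is_derive x (1 : R) f (f' x)}.
  move=> x xab; have xI := abI' _ xab.
  by rewrite /f' derive_inE// derive1E; exact/derivableP/fI.
pose k (x : R) := f x / x ^+ 2.
have ck : {within `[a, b], continuous k}.
  move=> x; apply: cvgM; first exact: cf.
  move: x; apply: continuous_in_subspaceT => x; rewrite inE/= => xab.
  apply: cvgV; last exact: exprn_continuous.
  by rewrite expf_neq0// gt_eqF// Ipos// abI.
have ik : (@lebesgue_measure R).-integrable `[a, b] (EFin \o k).
  by apply: continuous_compact_integrable => //; exact: segment_compact.
(* Based at [a], this primitive satisfies P(a) = 0, and P(b) is by definition the integral in the
   statement. *)
pose P := parameterized_integral (@lebesgue_measure R) a ^~ k.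
have cP : {within `[a, b], continuous P}.
  by apply: parameterized_integral_continuous => //; exact: ltW.
have dP : {in `]a, b[, forall x : R, is_derive x (1 : R) P (k x)}.
  move=> x xab; have := xab; rewrite in_itv/= => /andP[ax xb].
  have [dPx <-] := continuous_FTC1_closed xb ik ax
    (within_continuous_continuous ab ck xab).
  by rewrite derive1E; exact/derivableP.
have Pa : P a = 0.
  by rewrite /P /parameterized_integral set_itv1 Rintegral_set1.
have ba : b != a by rewrite gt_eqF.
have bound_b := half_midpoint_bound R a b a b h p q f f' P a0 aab bab
  (negbT (lt_eqF ab)) cf cP df dP q1 pq hc erefl.
have hE : h = 2 * b * a / (b + a) by rewrite /h; congr (_ / _); ring.
have bound_a := half_midpoint_bound R a b b a h p q f f' P a0 bab aab
  ba cf cP df dP q1 pq hc hE.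
have nba : `|b - a| = b - a by rewrite gtr0_norm// subr_gt0.
rewrite nba in bound_b; rewrite distrC nba (mulrC b a) in bound_a.
rewrite -[X in _ * X]/(P b).
(* Swapping [u] and [v] reverses the sign of the coefficient, so the two occurrences of P(h) cancel,
   while the halves of f(h) add up. *)
have -> : f h - a * b / (b - a) * P b =
    (f h / 2 + a * b / (b - a) * (P h - P b)) +
    (f h / 2 + a * b / (a - b) * (P h - P a)).
  by rewrite Pa; field; rewrite !subr_eq0 ba eq_sym ba.
apply: le_trans (ler_normD _ _) _; rewrite [leRHS]mulrDr.
exact: lerD bound_b bound_a.
Qed.
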